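(* Let $K\in\mathbb{R}^{M\times M}$ be a symmetric positive definite (kernel) matrix, $R\in\mathbb{R}^{M\times N}$, $\lambda\in\mathbb{R}^N$ with $\lambda\ge0$, $\nu\in\mathbb{R}$ and $\beta>0$, and let $a_i\in\mathbb{R}^M$ with $\|K^{1/2}a_i\|=1$ be the current kernel atom. Consider the problem $$\min_{a\in\mathbb{R}^M:\ \|K^{1/2}a\|=1,\ x\in\mathbb{R}^{1\times N}}\ \frac12\|x\|^2-x\,(R^TKa+\nu\lambda)+\beta\|x\| .$$ Let $$a^*=K^{-1/2}f^*,\qquad f^*\in\arg\max_{\|f\|=1}\ \frac12\|R^TK^{1/2}f+\nu\lambda\|_2^2$$ (so that computing $a^*$ reduces to a trust region problem, i.e. the optimization of a quadratic function over the unit sphere). Then a solution (global minimizer) of the problem is: if $\|R^TKa^*+\nu\lambda\|\ge\beta$, the pair $(a^*,x^*(a^* ))$ with $$x^*(a^* )=\left(1-\frac{\beta}{\|R^TKa^*+\nu\lambda\|}\right)(R^TKa^*+\nu\lambda)^T;$$ otherwise, the pair $(a_i,0)$.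
   Context: $\|\cdot\|$ and $\|\cdot\|_2$ denote the Euclidean vector norm, and $K^{1/2}$ is the symmetric positive definite square root of $K$, with inverse $K^{-1/2}$. Background: this is one K-SVD-type step for the kernel dictionary learning / one-class SVM (OC-SVM) objective $\frac12\|\varphi(Y)(I-AX)\|_F^2+\beta\sum_i\|x^i\|_2+G(X,\omega,\rho,\xi)$, where $\varphi$ is a feature map applied to the columns of the data matrix $Y$, $K=\varphi(Y)^T\varphi(Y)$ is the kernel matrix (of size equal to the number of training signals), the dictionary is $D=\varphi(Y)A$, $a_i$ is the $i$-th column of $A$ normalized by $a_i^TKa_i=1$, $x^i$ is the $i$-th row of $X$, $R=I-\sum_{j\ne i}a_jx^j$ is the residual (with columns restricted, as in K-SVD, to the signals using atom $i$; without restriction $N=M$), $\nu=\omega_i$ is the component of the OC-SVM normal vector $\omega$ corresponding to atom $i$, and $\lambda$ is the vector of OC-SVM Lagrange multipliers. *)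

(* Defs.v *)
From mathcomp Require Import all_boot all_order all_algebra.
From mathcomp Require Import sesquilinear.
From mathcomp Require Import all_classical all_reals.

Set Implicit Arguments.
Unset Strict Implicit.
Unset Printing Implicit Defensive.

Import Order.TTheory GRing.Theory Num.Theory.

Local Open Scope classical_set_scope.
Local Open Scope ring_scope.

(* Applied below to both row and column vectors, hence the generic shape.
   This is not the norm that mathcomp-analysis puts on matrices, which is the
   sup norm. *)
Definition enorm (R : realType) (m n : nat) (A : 'M[R]_(m, n)) : R :=
  Num.sqrt (\sum_i \sum_j A i j ^+ 2).

Definition spdmx (R : realType) (n : nat) (K : 'M[R]_n) : Prop :=
  K \is symmetricmx /\
  forall v : 'cV[R]_n, v != 0 -> 0 < (v^T *m K *m v) 0 0.

(* K^{1/2}, meaningful when K is symmetric positive definite: such a K has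
   exactly one symmetric positive definite square root. The value is 0 when
   there is none. *)
Definition sqrtmx (R : realType) (n : nat) (K : 'M[R]_n) : 'M[R]_n :=
  xget 0 [set S : 'M[R]_n | spdmx S /\ S *m S = K].

Definition is_global_min (R : realType) (T : Type) (D : set T) (f : T -> R)
    (t : T) : Prop :=
  D t /\ forall s, D s -> f t <= f s.

Definition is_global_max (R : realType) (T : Type) (D : set T) (f : T -> R)
    (t : T) : Prop :=
  D t /\ forall s, D s -> f s <= f t.

Section AtomUpdate.
Variables (R : realType) (M N : nat).
Variables (K : 'M[R]_M) (Res : 'M[R]_(M, N)) (lambda : 'cV[R]_N) (nu beta : R).

Definition corr (a : 'cV[R]_M) : 'cV[R]_N := Res^T *m K *m a + nu *: lambda.

Definition feasible : set ('cV[R]_M * 'rV[R]_N) :=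
  [set p | enorm (sqrtmx K *m p.1) = 1].

Definition objective (p : 'cV[R]_M * 'rV[R]_N) : R :=
  2^-1 * enorm p.2 ^+ 2 - (p.2 *m corr p.1) 0 0 + beta * enorm p.2.

Definition trust_region_objective (f : 'cV[R]_M) : R :=
  2^-1 * enorm (Res^T *m sqrtmx K *m f + nu *: lambda) ^+ 2.

Definition xstar (a : 'cV[R]_M) : 'rV[R]_N :=
  (1 - beta / enorm (corr a)) *: (corr a)^T.

End AtomUpdate.

(* Main.v *)
(** For fixed [a] the inner product [x *m corr a] is at most
    [enorm x * enorm (corr a)], so the objective at [(a, x)] is at least
    [t ^+ 2 / 2 - t * enorm (corr a) + beta * t] with [t := enorm x].  The
    substitution [f := K^{1/2} a] maps the feasible set onto the unit sphere and
    turns [enorm (corr a)] into the trust region objective, so [astar] maximizes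
    [enorm (corr a)] and gives the smallest of these parabolas.  Its minimum over
    [t >= 0] is attained at [t = enorm (corr astar) - beta] if this is
    nonnegative, and at [t = 0] otherwise. *)

Require Import Defs.
From mathcomp Require Import all_boot all_order all_algebra.
From mathcomp Require Import sesquilinear.
From mathcomp Require Import all_classical all_reals.
From mathcomp Require Import ring lra.

Set Implicit Arguments.
Unset Strict Implicit.
Unset Printing Implicit Defensive.

Import Order.TTheory GRing.Theory Num.Theory.

Local Open Scope classical_set_scope.
Local Open Scope ring_scope.

Lemma enorm_ge0 (R : realType) (m n : nat) (A : 'M[R]_(m, n)) : 0 <= enorm A.
Proof. exact: sqrtr_ge0. Qed.

Lemma enorm_sqr (R : realType) (m n : nat) (A : 'M[R]_(m, n)) :
  enorm A ^+ 2 = \sum_i \sum_j A i j ^+ 2.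
Proof.
by rewrite sqr_sqrtr //; do 2!apply: sumr_ge0 => ? _; rewrite sqr_ge0.
Qed.

Lemma enorm0 (R : realType) (m n : nat) : enorm (0 : 'M[R]_(m, n)) = 0.
Proof.
apply/eqP; rewrite -sqrf_eq0 enorm_sqr big1 // => i _.
by rewrite big1 // => j _; rewrite mxE expr0n.
Qed.

Lemma enorm_eq0 (R : realType) (m n : nat) (A : 'M[R]_(m, n)) :
  (enorm A == 0) = (A == 0).
Proof.
apply/eqP/eqP => [A0|->]; last exact: enorm0.
have /eqP := enorm_sqr A; rewrite A0 expr0n /= eq_sym psumr_eq0; last first.
  by move=> i _; apply: sumr_ge0 => j _; rewrite sqr_ge0.
move=> /allP h; apply/matrixP => i j; rewrite mxE.
have := h i (mem_index_enum i); rewrite psumr_eq0; last first.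
  by move=> k _; rewrite sqr_ge0.
by move=> /allP /(_ j (mem_index_enum j)); rewrite sqrf_eq0 => /eqP.
Qed.

Lemma enorm_trmx (R : realType) (m n : nat) (A : 'M[R]_(m, n)) :
  enorm A^T = enorm A.
Proof.
rewrite /enorm exchange_big /=; congr Num.sqrt.
by apply: eq_bigr => i _; apply: eq_bigr => j _; rewrite mxE.
Qed.

Lemma enormZ (R : realType) (m n : nat) (a : R) (A : 'M[R]_(m, n)) :
  enorm (a *: A) = `|a| * enorm A.
Proof.
rewrite /enorm -sqrtr_sqr -sqrtrM ?sqr_ge0 // mulr_sumr; congr Num.sqrt.
apply: eq_bigr => i _; rewrite mulr_sumr; apply: eq_bigr => j _.
by rewrite mxE exprMn.
Qed.

Lemma enorm_sqr_row (R : realType) (n : nat) (x : 'rV[R]_n) :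
  enorm x ^+ 2 = (x *m x^T) 0 0.
Proof.
rewrite enorm_sqr big_ord1 mxE.
by apply: eq_bigr => j _; rewrite mxE expr2.
Qed.

(** Cauchy-Schwarz: the squared norm of [enorm c *: x - enorm x *: c^T] expands to [2 * (enorm x *
    enorm c) * (enorm x * enorm c - x c)], and the positive factor can be cancelled once [x] and [c]
    are nonzero. *)
Lemma mulmx_le_enorm (R : realType) (n : nat) (x : 'rV[R]_n) (c : 'cV[R]_n) :
  (x *m c) 0 0 <= enorm x * enorm c.
Proof.
have [->|x0] := eqVneq x 0; first by rewrite mul0mx mxE enorm0 mul0r.
have [->|c0] := eqVneq c 0; first by rewrite mulmx0 mxE enorm0 mulr0.
have xc0 : 0 < enorm x * enorm c.
  by rewrite mulr_gt0 // lt_neqAle eq_sym enorm_eq0 enorm_ge0 andbT.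
have := sqr_ge0 (enorm (enorm c *: x - enorm x *: c^T)).
have cx : (c^T *m x^T) 0 0 = (x *m c) 0 0 by rewrite -trmx_mul mxE.
have cc : (c^T *m c) 0 0 = enorm c ^+ 2.
  by rewrite -(enorm_trmx c) enorm_sqr_row trmxK.
(* Abstract 1x1 matrices keep [mxE] from unfolding the products into sums. *)
have entry (p q s r : R) (A B C D : 'M[R]_1) :
    (p *: A - q *: B - (s *: C - r *: D)) 0 0
      = p * A 0 0 - q * B 0 0 - (s * C 0 0 - r * D 0 0) by rewrite !mxE.
have trB : (enorm c *: x - enorm x *: c^T)^T = enorm c *: x^T - enorm x *: c.
  by apply/matrixP => i j; rewrite !mxE.
rewrite enorm_sqr_row trB mulmxBl !mulmxBr.
rewrite -!scalemxAl -!scalemxAr !scalerA.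
rewrite entry cx cc.
rewrite -enorm_sqr_row => h.
rewrite -subr_ge0 -(pmulr_rge0 _ xc0); lra.
Qed.

(** A nonzero kernel vector would make the quadratic form vanish. *)
Lemma spdmx_unit (R : realType) (n : nat) (S : 'M[R]_n) :
  spdmx S -> S \in unitmx.
Proof.
move=> [_ S_pos]; rewrite -unitmx_tr -row_free_unit.
apply: inj_row_free => v vS; apply/eqP; apply: contraT => v0.
have := S_pos v^T; rewrite trmx_eq0 => /(_ v0).
by rewrite -mulmxA -[S]trmxK -trmx_mul vS trmx0 mulmx0 mxE ltxx.
Qed.

(* The junk value [0] of [sqrtmx] admits no normalized atom. *)
Lemma sqrtmx_spec (R : realType) (n : nat) (K : 'M[R]_n) (a : 'cV[R]_n) :
  enorm (sqrtmx K *m a) = 1 -> spdmx (sqrtmx K) /\ sqrtmx K *m sqrtmx K = K.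
Proof.
rewrite /sqrtmx; case: xgetP => [S _ //|_].
by rewrite mul0mx enorm0 => /esym/eqP; rewrite oner_eq0.
Qed.

(** Leaving [c] an upper bound lets one parabola, with [c] the maximal correlation norm, bound the
    objective for all feasible [a] at once. *)
Lemma objective_ge (R : realType) (M N : nat) (K : 'M[R]_M)
    (Res : 'M[R]_(M, N)) (lambda : 'cV[R]_N) (nu beta c : R)
    (a : 'cV[R]_M) (x : 'rV[R]_N) :
  enorm (corr K Res lambda nu a) <= c ->
  2^-1 * enorm x ^+ 2 - enorm x * c + beta * enorm x
    <= objective K Res lambda nu beta (a, x).
Proof.
move=> le_c; rewrite /objective /= lerD2r lerD2l lerN2.
by rewrite (le_trans (mulmx_le_enorm _ _)) // ler_wpM2l // enorm_ge0.
Qed.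

(** [xstar] is a nonnegative multiple of the transposed correlation, so Cauchy-Schwarz is an
    equality there; its norm is [enorm (corr a) - beta], the vertex of the parabola. *)
Lemma objective_xstar (R : realType) (M N : nat) (K : 'M[R]_M)
    (Res : 'M[R]_(M, N)) (lambda : 'cV[R]_N) (nu beta : R) (a : 'cV[R]_M) :
  0 < beta -> beta <= enorm (corr K Res lambda nu a) ->
  objective K Res lambda nu beta (a, xstar K Res lambda nu beta a)
    = - (2^-1 * (enorm (corr K Res lambda nu a) - beta) ^+ 2).
Proof.
move=> beta0; rewrite /objective /xstar /=.
set c := corr _ _ _ _ _ => le_c.
(* Positivity of [beta] makes the quotient in [xstar] a genuine division. *)
have c_gt0 : 0 < enorm c by apply: lt_le_trans le_c.
rewrite -scalemxAl mxE -[c in _ *m c]trmxK -enorm_sqr_row.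
rewrite enormZ enorm_trmx ger0_norm; last first.
  by rewrite subr_ge0 ler_pdivrMr // mul1r.
by field; rewrite gt_eqF.
Qed.

Theorem corollary6 (R : realType) (M N : nat)
    (K : 'M[R]_M) (Res : 'M[R]_(M, N)) (lambda : 'cV[R]_N) (nu beta : R)
    (ai fstar : 'cV[R]_M)
    (K_spd : spdmx K)
    (lambda_ge0 : forall j, 0 <= lambda j 0)
    (beta_gt0 : 0 < beta)
    (ai_normalized : enorm (sqrtmx K *m ai) = 1)
    (fstar_argmax : is_global_max [set f : 'cV[R]_M | enorm f = 1]
                      (trust_region_objective K Res lambda nu) fstar) :
  let astar := invmx (sqrtmx K) *m fstar in
  (beta <= enorm (corr K Res lambda nu astar) ->
     is_global_min (feasible K) (objective K Res lambda nu beta)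
       (astar, xstar K Res lambda nu beta astar)) /\
  (enorm (corr K Res lambda nu astar) < beta ->
     is_global_min (feasible K) (objective K Res lambda nu beta)
       (ai, 0 : 'rV[R]_N)).
Proof.
move=> astar.
have [S_spd SS] := sqrtmx_spec ai_normalized.
have S_unit := spdmx_unit S_spd.
have S_astar : sqrtmx K *m astar = fstar by rewrite mulKVmx.
have [fstar1 fstar_max] := fstar_argmax.
have trE a : trust_region_objective K Res lambda nu (sqrtmx K *m a) =
    2^-1 * enorm (corr K Res lambda nu a) ^+ 2.
  by rewrite /trust_region_objective /corr -!mulmxA mulmxA !mulmxA
             -(mulmxA Res^T) SS.
have corr_max a : enorm (sqrtmx K *m a) = 1 ->
    enorm (corr K Res lambda nu a) <= enorm (corr K Res lambda nu astar).
  move=> /fstar_max; rewrite -S_astar !trE ler_pM2l ?invr_gt0 ?ltr0n //.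
  by rewrite ler_sqr ?nnegrE ?enorm_ge0.
split=> le_c; split.
- by rewrite /feasible /= S_astar.
- move=> [a x] /corr_max /objective_ge le_obj.
  rewrite objective_xstar // (le_trans _ (le_obj beta x)) // -subr_ge0.
  (* Half of this square is the gap between the parabola at [enorm x] and its minimum. *)
  have := sqr_ge0 (enorm x - (enorm (corr K Res lambda nu astar) - beta)).
  by lra.
- exact: ai_normalized.
- move=> [a x] /corr_max /objective_ge le_obj.
  (* At [x = 0] the objective is 0 whatever the atom, so it remains to see that the parabola is
     nonnegative; below the threshold both its quadratic and its linear term are. *)
  rewrite {1}/objective /= enorm0 mul0mx mxE expr0n /= !mulr0 subr0 addr0.
  rewrite (le_trans _ (le_obj beta x)) //.
  have : 0 <= enorm x * (beta - enorm (corr K Res lambda nu astar)).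
    by rewrite mulr_ge0 ?enorm_ge0 // subr_ge0 ltW.
  by have := sqr_ge0 (enorm x); lra.
Qed.
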